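(* Let $J$ be a finite set with $m:=|J|\ge 3$, let $\Pi=(P_x)_{x\in J}$ be a partition of a finite set $P$ of participants, let $\mathcal{Z}=(J,h,\boldsymbol g)$ be a uniform polymatroid with increment sequence $\boldsymbol g=(g_i)_{0\le i\le m}$ and $0<g_0<|P_x|$ for all $x\in J$, let $\Delta\subseteq\mathcal{P}(J)\setminus\{\emptyset\}$ be a monotone increasing family compatible with $\mathcal{Z}$, and let $\Gamma=\Gamma(\Pi,\mathcal{Z},\Delta)$. If $g_1>g_{m-1}$ and $\mu(\Delta):=\min\{|X|:X\in\Delta\}>1$, then the access structure $\Gamma$ is compartmented.
   Context: Polymatroids. For a finite set $J$ let $\mathcal{P}(J)$ be its power set. An (integer) polymatroid is a pair $(J,h)$ with $h:\mathcal{P}(J)\to\mathbb{N}_0$ such that $h(\emptyset)=0$, $h(X)\le h(Y)$ if $X\subseteq Y$, and $h(X\cap Y)+h(X\cup Y)\le h(X)+h(Y)$. It is uniform if $h(X)=h(Y)$ whenever $|X|=|Y|$; write $h_i=h(X)$ for $|X|=i$. With $m=|J|$, its increment sequence is $\boldsymbol g=(g_0,\dots,g_m)$, $g_i=h_{i+1}-h_i$ for $0\le i\le m-1$ and $g_m=0$; it is a nonincreasing sequence of nonnegative integers, and $g_0>0$ is assumed. Such a polymatroid is written $\mathcal{Z}=(J,h,\boldsymbol g)$. Compatibility. A monotone increasing family $\Delta\subseteq\mathcal{P}(J)\setminus\{\emptyset\}$ is a nonempty family of nonempty subsets of $J$ closed under taking supersets in $J$. Fix $x_0\notin J$ and define $h'$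 on $\mathcal{P}(J\cup\{x_0\})$ by $h'(X)=h(X)$ for $X\subseteq J$, $h'(X\cup\{x_0\})=h(X)$ if $X\in\Delta$, and $h'(X\cup\{x_0\})=h(X)+1$ if $X\subseteq J$, $X\notin\Delta$. $\Delta$ is compatible with $\mathcal{Z}$ if $h'$ is monotone increasing and submodular. Access structure. A partition $\Pi=(P_x)_{x\in J}$ of $P$ consists of pairwise disjoint nonempty sets (blocks) with union $P$. For $A\subseteq P$ put $\pi(A)=(|A\cap P_x|)_{x\in J}\in\mathbb{N}_0^J$. For $\bar v\in\mathbb{N}_0^J$ and $Y\subseteq J$ put $\mathrm{supp}(\bar v)=\{x:v_x\ne0\}$, $|\bar v|=\sum_{x\in J}v_x$, $|\bar v_Y|=\sum_{x\in Y}v_x$. For $X\subseteq J$ let $\mathcal{B}(\mathcal{Z},X)=\{\bar v\in\mathbb{N}_0^J:\mathrm{supp}(\bar v)\subseteq X,\ |\bar v|=h(X),\ |\bar v_Y|\le h(Y)\text{ for all }Y\subseteq X\}$. Then $\Gamma(\Pi,\mathcal{Z},\Delta)$ is the family of all $A\subseteq P$ such that $\pi(A)\ge\bar v$ (coordinatewise) for some $\bar v\in\bigcup_{X\in\Delta}\mathcal{B}(\mathcal{Z},X)$. Hierarchy. For participants $p,q\in P$ write $q\preccurlyeq p$ if $A\cup\{p\}\in\Gamma$ for all $A\subseteq P\setminus\{p,q\}$ with $A\cup\{q\}\in\Gamma$. For blocks, $P_y\preccurlyeq P_x$ means $q\preccurlyeq p$ for some (equivalently, all) $q\in P_y$, $p\in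 P_x$. Two blocks $P_x,P_y$ are hierarchically independent if neither $P_x\preccurlyeq P_y$ nor $P_y\preccurlyeq P_x$. $\Gamma$ is compartmented if every two different blocks of $\Pi$ are hierarchically independent. *)

(* Defs.v *)
From mathcomp Require Import all_boot.

Set Implicit Arguments.
Unset Strict Implicit.
Unset Printing Implicit Defensive.

Section Polymatroids.

Variable J : finType.
Implicit Types (h : {set J} -> nat) (X Y : {set J}).

Definition monotone_increasing h : Prop :=
  forall X Y, X \subset Y -> h X <= h Y.

Definition submodular h : Prop :=
  forall X Y, h (X :&: Y) + h (X :|: Y) <= h X + h Y.

Definition polymatroid h : Prop :=
  [/\ h set0 = 0, monotone_increasing h & submodular h].

Definition uniform h : Prop :=
  forall X Y, #|X| = #|Y| -> h X = h Y.

(* With h_i the common value of a uniform [h] on the sets of size i, this reads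
   g_i = h_{i+1} - h_i for i < #|J|, and g_i = 0 for i = #|J|.  The values of
   [g] above #|J| are unconstrained.  The subtraction never truncates when [h]
   is a uniform polymatroid. *)
Definition increment_sequence h (g : nat -> nat) : Prop :=
  (forall X Y, #|Y| = #|X|.+1 -> g #|X| = h Y - h X) /\ g #|J| = 0.

Definition monotone_family (Delta : {set {set J}}) : Prop :=
  [/\ Delta != set0, set0 \notin Delta
    & forall X Y, X \in Delta -> X \subset Y -> Y \in Delta].

(* All sizes are at most #|J|, so the default value #|J| does not affect the
   minimum when [Delta] is nonempty. *)
Definition mu (Delta : {set {set J}}) : nat :=
  \big[minn/#|J|]_(X in Delta) #|X|.

(* J with an added point x0 is [option J], and x0 is [None]. *)
Definition extension h (Delta : {set {set J}}) (X : {set option J}) : nat :=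
  let Y := [set x | Some x \in X] in
  if (None \in X) && (Y \notin Delta) then (h Y).+1 else h Y.

End Polymatroids.

Definition compatible (J : finType) (h : {set J} -> nat)
    (Delta : {set {set J}}) : Prop :=
  monotone_increasing (extension h Delta) /\ submodular (extension h Delta).

Section AccessStructures.

Variables J P : finType.
Implicit Types (Pi : J -> {set P}) (h : {set J} -> nat) (v : {ffun J -> nat}).

Definition partition_into_blocks Pi : Prop :=
  [/\ forall x, Pi x != set0,
      forall x y, x != y -> [disjoint Pi x & Pi y]
    & \bigcup_(x : J) Pi x = [set: P]].

Definition block_counts Pi (A : {set P}) : {ffun J -> nat} :=
  [ffun x => #|A :&: Pi x|].

Definition supp v : {set J} := [set x | v x != 0].

Definition basis h (X : {set J}) v : Prop :=
  [/\ supp v \subset X, \sum_(x : J) v x = h X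
    & forall Y : {set J}, Y \subset X -> \sum_(x in Y) v x <= h Y].

Definition access_structure Pi h (Delta : {set {set J}}) (A : {set P}) : Prop :=
  exists v, (exists2 X, X \in Delta & basis h X v) /\
            (forall x, v x <= block_counts Pi A x).

(* [hier_le Gamma q p] is "q is hierarchically below p". *)
Definition hier_le (Gamma : {set P} -> Prop) (q p : P) : Prop :=
  forall A : {set P},
    A \subset ~: [set p; q] -> Gamma (q |: A) -> Gamma (p |: A).

Definition block_le (Gamma : {set P} -> Prop) (B C : {set P}) : Prop :=
  exists q p, [/\ q \in B, p \in C & hier_le Gamma q p].

Definition hier_independent (Gamma : {set P} -> Prop) (B C : {set P}) : Prop :=
  ~ block_le Gamma B C /\ ~ block_le Gamma C B.

Definition compartmented Pi (Gamma : {set P} -> Prop) : Prop :=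
  forall x y : J, x != y -> hier_independent Gamma (Pi x) (Pi y).

End AccessStructures.

(* Main.v *)
(* It suffices to find, for blocks x <> y, a count vector u such that u + e_y is
   in the access structure and u + e_x is not.  Take u = v - e_y, where v is
   the greedy vertex of the base polytope of h for an ordering x, y, S, rest of J, so that
   v_x = g_0 and v_y = g_1.  If some basis of a set Z in Delta lies below
   u + e_x, then y is not in Z and v is tight on Z; comparing h at Z, at Z + y
   and at Z - z gives g_1 <= g_|Z| <= g_(|Z|-1) <= v_z for every z in Z.
   Choose S maximal avoiding x, y with x + S not in Delta and g_(|S|+1) = g_1:
   compatibility makes h strictly submodular where Delta is not closed under
   intersection, which forces v < g_1 on the rest.  Thus Z is contained in
   x + S, which contradicts the choice of S. *)

Require Import Defs.
From mathcomp Require Import all_boot.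

Set Implicit Arguments.
Unset Strict Implicit.
Unset Printing Implicit Defensive.

(** * Preliminaries on [mu], compatible families and finite sets *)

Lemma mu_le_card (J : finType) (Delta : {set {set J}}) (X : {set J}) :
  X \in Delta -> mu Delta <= #|X|.
Proof.
rewrite /mu => XD; have := mem_index_enum X.
elim: (index_enum _) => // Y s IHs; rewrite in_cons big_cons.
case/orP => [/eqP <- | Xs]; first by rewrite XD geq_minl.
by case: ifP => _; rewrite ?geq_min IHs ?orbT.
Qed.

(** Submodularity of the extension is applied to [X] and [Y], both with the new point adjoined. As
    [X], [Y] and their union lie in [Delta], the extra unit appears only at the intersection, which
    makes the inequality strict. *)
Lemma compatible_lt (J : finType) (h : {set J} -> nat) (Delta : {set {set J}})
    (X Y : {set J}) :
  compatible h Delta -> X \in Delta -> Y \in Delta -> X :|: Y \in Delta ->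
  X :&: Y \notin Delta -> h (X :&: Y) + h (X :|: Y) < h X + h Y.
Proof.
move=> [_ sub] XD YD UD ID.
pose add0 (Z : {set J}) : {set option J} := None |: [set Some z | z in Z].
have add0K Z : [set z | Some z \in add0 Z] = Z.
  by apply/setP=> z; rewrite !inE /= mem_imset //; apply: Some_inj.
have memN Z : None \in add0 Z by rewrite !inE.
have add0I : add0 X :&: add0 Y = add0 (X :&: Y).
  by rewrite /add0 -setUIr imsetI //; apply: in2W; apply: Some_inj.
have add0U : add0 X :|: add0 Y = add0 (X :|: Y).
  by rewrite /add0 -setUUr imsetU.
have := sub (add0 X) (add0 Y).
by rewrite add0I add0U /extension !memN !add0K XD YD UD ID.
Qed.

Lemma exists_subset_card (T : finType) (B : {set T}) (n : nat) :
  n <= #|B| -> exists2 X : {set T}, X \subset B & #|X| = n.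
Proof.
rewrite -bin_gt0 -cards_draws card_gt0 => /set0Pn[X].
by rewrite inE => /andP[sXB /eqP]; exists X.
Qed.

Lemma setU1_I (T : finType) (a b : T) (X : {set T}) :
  a != b -> (a |: X) :&: (b |: X) = X.
Proof.
move=> neq_ab; rewrite -setUIl; suff -> : [set a] :&: [set b] = set0.
  exact: set0U.
by apply/setP=> z; rewrite !inE; case: eqP => // ->; rewrite (negPf neq_ab).
Qed.

Lemma setU1_U (T : finType) (a b : T) (X : {set T}) :
  (a |: X) :|: (b |: X) = b |: (a |: X).
Proof. by rewrite setUC -setUUl -setUA. Qed.

(** * Increments of a uniform polymatroid and greedy bases *)

Section UniformPolymatroid.

Variables (J : finType) (h : {set J} -> nat) (g : nat -> nat).
Hypotheses (hpoly : polymatroid h) (hg : increment_sequence h g).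
Implicit Types (X Y : {set J}).

Lemma h_setU1 z X : z \notin X -> h (z |: X) = h X + g #|X|.
Proof.
case: hpoly hg => _ mono _ [hgX _] zX.
by rewrite (hgX X (z |: X)) ?cardsU1 ?zX // subnKC // mono // subsetUr.
Qed.

(** Submodularity at [a |: X] and [b |: X] with [#|X| = j] gives [g j.+1 <= g j]; the bound on the
    index provides two points outside [X]. *)
Lemma increment_le i j : i <= j -> j < #|J| -> g j <= g i.
Proof.
elim: j => [|j IHj]; first by rewrite leqn0 => /eqP ->.
rewrite leq_eqVlt => /predU1P[-> // | le_ij lt_jm].
apply: leq_trans (IHj le_ij (ltnW lt_jm)).
have [|X _ cX] := @exists_subset_card _ [set: J] j.
  by rewrite cardsT ltnW // ltnW.
have : 1 < #|~: X| by rewrite cardsCs setCK cX ltn_subRL addn1.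
case/card_gt1P=> a [b []]; rewrite !inE => aX bX neq_ab.
have bXa : b \notin a |: X by rewrite !inE negb_or eq_sym neq_ab.
case: hpoly => _ _ /(_ (a |: X) (b |: X)).
rewrite setU1_I // setU1_U !h_setU1 // cardsU1 aX cX add1n.
by rewrite -!addnA leq_add2l [g j + (h X + _)]addnCA leq_add2l leq_add2l.
Qed.

Lemma h_sum X : h X = \sum_(i < #|X|) g i.
Proof.
move: {2}#|X| (erefl #|X|) => n; elim: n X => [|n IHn] X cX.
  by rewrite cX big_ord0 (cards0_eq cX); case: hpoly.
have /card_gt0P[z zX] : 0 < #|X| by rewrite cX.
have cXz : #|X :\ z| = n by move: cX; rewrite (cardsD1 z) zX => -[].
have := h_setU1 (z := z) (X := X :\ z); rewrite setD1K // setD11 (IHn _ cXz) cXz.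
by move=> -> //; rewrite cX big_ord_recr.
Qed.

Section Greedy.

Variable s : seq J.
Hypotheses (s_uniq : uniq s) (s_full : forall z, z \in s).

Definition greedy : {ffun J -> nat} := [ffun z => g (index z s)].

Lemma size_full_uniq : size s = #|J|.
Proof.
by rewrite -(card_uniqP s_uniq); apply: eq_card => z; rewrite s_full.
Qed.

(** Remove the element [z] of [Y] that comes last in [s]. All of [Y] lies among the first
    [(index z s).+1] entries, so [#|Y :\ z| <= index z s], and [greedy z] is at most the increment
    [g #|Y :\ z|]. *)
Lemma sum_greedy_le Y : \sum_(z in Y) greedy z <= h Y.
Proof.
move: {2}#|Y| (leqnn #|Y|) => n; elim: n Y => [|n IHn] Y.
  by rewrite leqn0 cards_eq0 => /eqP ->; rewrite big_set0.
have [-> _|/set0Pn[z0 z0Y] leYn] := eqVneq Y set0; first by rewrite big_set0.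
case: (arg_maxnP (fun z => index z s) z0Y) => z zY max_z.
have {}zY : z \in Y by [].
have cY : #|Y| = #|Y :\ z|.+1 by rewrite (cardsD1 z) zY.
rewrite (big_setD1 z zY) /= addnC.
have -> : h Y = h (Y :\ z) + g #|Y :\ z|.
  by rewrite -(@h_setU1 z) ?setD11 ?setD1K.
apply: leq_add; first by apply: IHn; rewrite -ltnS -cY.
rewrite ffunE; apply: increment_le; last by rewrite -size_full_uniq index_mem.
have lt_zs : index z s < size s by rewrite index_mem.
rewrite -ltnS -cY -(size_takel lt_zs).
rewrite cardE; apply: uniq_leq_size (enum_uniq _) _ => t; rewrite mem_enum => tY.
by rewrite in_take // ltnS; apply: max_z.
Qed.

Lemma basis_greedy : basis h [set: J] greedy.
Proof.
split=> [||Y _]; [exact: subsetT | | exact: sum_greedy_le].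
have perm_s : perm_eq (index_enum J) s.
  apply: uniq_perm; rewrite ?index_enum_uniq // => z.
  by rewrite mem_index_enum s_full.
rewrite (perm_big _ perm_s) h_sum cardsT -size_full_uniq.
have [z0 _|J0] := pickP J; last first.
  have s0 : s = [::] by case: (s) => // z ?; have := J0 z.
  by rewrite s0 big_nil big_ord0.
rewrite (big_nth z0) big_mkord; apply: eq_bigr => i _.
by rewrite ffunE index_uniq.
Qed.

End Greedy.

(** * The separating basis and the sets whose bases it dominates *)

Lemma separating_basis (Delta : {set {set J}}) (x y : J) :
    monotone_family Delta -> compatible h Delta -> g #|J|.-1 < g 1 ->
    [set x] \notin Delta -> x != y ->
  exists2 v, basis h [set: J] v &
  exists2 S, x |: S \notin Delta &
    [/\ v x = g 0, v y = g 1, forall z, v z <= g 0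
      & forall z, z != x -> z != y -> z \notin S -> v z < g 1].
Proof.
move=> [_ _ upD] compD g1 xD neq_xy.
have J_gt1 : 1 < #|J| by apply/card_gt1P; exists x, y.
pose good (S : {set J}) :=
  [&& S \subset ~: [set x; y], x |: S \notin Delta & g #|S|.+1 == g 1].
have good0 : good set0 by rewrite /good sub0set setU0 xD cards0 eqxx.
case: (arg_maxnP (fun S : {set J} => #|S|) good0) => S.
move=> /and3P[sSxy SD /eqP gS] maxS.
have cC : #|~: [set x; y]| = #|J|.-2 by rewrite cardsCs setCK cards2 neq_xy subn2.
pose rest := ~: (x |: (y |: S)).
pose s := x :: y :: enum S ++ enum rest.
have [xS yS] : x \notin S /\ y \notin S.
  by split; apply/negP=> /(subsetP sSxy); rewrite !inE eqxx ?orbT.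
have s_uniq : uniq s.
  rewrite /= cat_uniq !enum_uniq !inE !mem_cat !mem_enum !inE !eqxx !orbT.
  rewrite (negPf neq_xy) (negPf xS) (negPf yS) /= andbT.
  by apply/hasPn=> z; rewrite !mem_enum !inE !negb_or => /and3P[].
have s_full z : z \in s.
  rewrite !inE mem_cat !mem_enum !inE.
  by case: eqP; case: eqP; case: (z \in S).
have s_size := size_full_uniq s_uniq s_full.
exists (greedy s); first exact: basis_greedy.
exists S => //; split=> [|| z | z zx zy zS]; rewrite ffunE.
- by rewrite /= eqxx.
- by rewrite /= (negPf neq_xy) eqxx.
- by rewrite increment_le // -s_size index_mem.
have lt_zm : index z s < #|J| by rewrite -s_size index_mem.
have le_Sz : #|S|.+2 <= index z s.
  rewrite /= !(eq_sym _ z) (negPf zx) (negPf zy) !ltnS index_cat mem_enum.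
  by rewrite (negPf zS) -cardE leq_addr.
apply: leq_ltn_trans (increment_le le_Sz lt_zm) _.
have lt_Sm := leq_ltn_trans le_Sz lt_zm.
(* As [z] follows [x], [y] and [S] in [s], only the case [g #|S|.+2 = g 1] remains to be
   excluded. *)
rewrite ltn_neqAle increment_le // andbT; apply/negP=> /eqP gS2.
(* Since [g #|J|.-1 < g 1], position [#|S|.+2] is not the last one, so at least two points remain
   outside [x], [y] and [S]. *)
have lt_Sm1 : #|S|.+2 < #|J|.-1.
  rewrite ltn_neqAle -ltnS prednK ?(ltnW J_gt1) // lt_Sm andbT.
  by apply/eqP=> eqm; rewrite -eqm gS2 ltnn in g1.
have : 1 < #|~: [set x; y] :\: S|.
  rewrite cardsD (setIidPr sSxy) cC ltn_subRL addn1.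
  by rewrite -ltnS prednK // -subn1 subn_gt0.
case/card_gt1P=> a [b []]; rewrite in_setD => /andP[aS axy].
rewrite in_setD => /andP[bS bxy] neq_ab.
(* By [gS2], adding [t] to [S] keeps the increment condition, so by maximality of [S] the condition
   on [Delta] must fail. *)
have step t : t \notin S -> t \in ~: [set x; y] -> t |: (x |: S) \in Delta.
  move=> tS txy; apply: contraT => tD.
  have : good (t |: S).
    by rewrite /good subUset sub1set txy sSxy setUCA tD cardsU1 tS gS2 eqxx.
  by move/maxS; rewrite /= cardsU1 tS ltnn.
have notx t : t \notin S -> t \in ~: [set x; y] -> t \notin x |: S.
  by rewrite !inE !negb_or => -> /andP[-> _].
have [aX bX] := (notx a aS axy, notx b bS bxy).
have bXa : b \notin a |: (x |: S).
  by rewrite in_setU1 negb_or eq_sym neq_ab.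
(* These two members of [Delta] meet in [x |: S], outside [Delta]; strictness yields
   [g #|S|.+2 < g #|S|.+1], although both equal [g 1]. *)
have := compatible_lt compD (step a aS axy) (step b bS bxy).
rewrite setU1_I // setU1_U => /(_ (upD _ _ (step a aS axy) (subsetUr _ _)) SD).
rewrite !h_setU1 // !cardsU1 aX xS !add1n gS gS2.
move: (h S + _) => e.
by rewrite [e + g 1 + (e + _)]addnACA -[e + g 1 + g 1]addnA addnA ltnn.
Qed.

Lemma dominated_basis_subset (x y : J) (v w : {ffun J -> nat}) (Z S : {set J}) :
    basis h [set: J] v -> v x = g 0 -> v y = g 1 -> x != y ->
    (forall z, z != x -> z != y -> z \notin S -> v z < g 1) ->
    basis h Z w -> (forall z, z != x -> w z + (z == y) <= v z) ->
  Z \subset x |: S.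
Proof.
move=> [_ _ vle] vx vy neq_xy vS [wZ sumw wle] wv.
have {}vle Y : \sum_(z in Y) v z <= h Y by apply: vle; apply: subsetT.
have h0 : h set0 = 0 by case: hpoly.
have w0 z : z \notin Z -> w z = 0.
  by apply: contraNeq => wz; apply: (subsetP wZ); rewrite inE.
(* The bound extends to [x]: if [x] is in [Z], then [w x <= h [set x] = g 0 = v x]. *)
have {}wv z : w z + (z == y) <= v z.
  have [->|/wv //] := eqVneq z x; rewrite (negPf neq_xy) addn0 vx.
  have [xZ|/w0 -> //] := boolP (x \in Z).
  have := wle [set x]; rewrite sub1set big_set1 -[[set x]]setU0.
  by rewrite h_setU1 ?inE // h0 cards0; apply.
have sumwZ : \sum_(z in Z) w z = h Z.
  by rewrite -sumw [RHS](bigID (mem Z)) /= [X in _ + X]big1 ?addn0 //.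
(* Otherwise the spare unit at [y] gives [h Z + 1 <= h Z]: [w] already sums to [h Z] on [Z], and [v]
   cannot exceed it. *)
have yZ : y \notin Z.
  apply/negP=> yZ; have : \sum_(z in Z) (w z + (z == y)) <= h Z.
    by apply: leq_trans (vle Z); apply: leq_sum => z _.
  rewrite big_split /= sumwZ (bigD1 y yZ) /= eqxx.
  by rewrite add1n addnS ltnNge leq_addr.
have sumvZ : \sum_(z in Z) v z = h Z.
  apply/eqP; rewrite eqn_leq vle -sumwZ leq_sum // => z _.
  exact: leq_trans (leq_addr _ _) (wv z).
have le_g1 : g 1 <= g #|Z|.
  have := vle (y |: Z).
  by rewrite big_setU1 //= sumvZ vy h_setU1 // addnC leq_add2l.
have lt_Zm : #|Z| < #|J|.
  rewrite -cardsT proper_card // properEneq subsetT andbT.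
  by apply: contraNneq yZ => ->; rewrite inE.
apply/subsetP=> z zZ; rewrite !inE; have [//|zx] := eqVneq z x.
apply: contraT => /= zS.
have zy : z != y by apply: contraNneq yZ => <-.
have := vS z zx zy zS; rewrite ltnNge => /negP[].
apply: leq_trans le_g1 _.
have cZ : #|Z| = #|Z :\ z|.+1 by rewrite (cardsD1 z) zZ.
apply: (@leq_trans (g #|Z :\ z|)).
  by apply: increment_le; rewrite // cZ.
(* As [v] sums to [h Z] on [Z], its bound on [Z :\ z] forces [v z] to be at least the increment
   [g #|Z :\ z|]. *)
have := vle (Z :\ z).
rewrite -(leq_add2l (v z)) -big_setD1 //= sumvZ -{1}(setD1K zZ).
by rewrite h_setU1 ?setD11 // addnC leq_add2r.
Qed.

End UniformPolymatroid.

(** * From count vectors to sets of participants *)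

(** Choose [u z] participants outside [C] in each block and take the union; by disjointness the
    choices do not interfere. *)
Lemma exists_set_counts (J P : finType) (Pi : J -> {set P}) (C : {set P})
    (u : J -> nat) :
    (forall x y, x != y -> [disjoint Pi x & Pi y]) ->
    (forall z, u z <= #|Pi z :\: C|) ->
  exists2 A : {set P}, A \subset ~: C & forall z, #|A :&: Pi z| = u z.
Proof.
move=> disj le_u.
have /fin_all_exists2[B sB cB] z := exists_subset_card (le_u z).
exists (\bigcup_z B z) => [|z].
  by apply/bigcupsP=> z _; apply: subset_trans (sB z) (subsetDr _ _).
rewrite -(cB z); congr #|pred_of_set _|; apply/setP=> p; rewrite inE.
apply/andP/idP=> [[/bigcupP[t _ pt] pz] | pz]; last first.
  by split; [apply/bigcupP; exists z | case/setDP: (subsetP (sB z) _ pz)].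
have [<- //|/disj/pred0P/(_ p)] := eqVneq t z.
by rewrite /= pz andbT; case/setDP: (subsetP (sB t) _ pt) => ->.
Qed.

Theorem theorem4p3 (J P : finType) (Pi : J -> {set P})
    (h : {set J} -> nat) (g : nat -> nat) (Delta : {set {set J}})
    (hm : 3 <= #|J|)
    (hPi : partition_into_blocks Pi)
    (hpoly : polymatroid h)
    (hunif : uniform h)
    (hg : increment_sequence h g)
    (hg0 : 0 < g 0)
    (hg0P : forall x : J, g 0 < #|Pi x|)
    (hDelta : monotone_family Delta)
    (hcompat : compatible h Delta)
    (hg1 : g #|J|.-1 < g 1)
    (hmu : 1 < mu Delta) :
  compartmented Pi (access_structure Pi h Delta).
Proof.
have disj x y : x != y -> [disjoint Pi x & Pi y] by case: hPi => _ + _; apply.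
suff no_le x y : x != y ->
    ~ block_le (access_structure Pi h Delta) (Pi y) (Pi x).
  by move=> x y neq_xy; split; apply: no_le; rewrite // eq_sym.
move=> neq_xy [q [p [qy px hier]]].
have xD : [set x] \notin Delta.
  apply: contraL hmu => /mu_le_card; rewrite cards1 -leqNgt; exact.
have JD : [set: J] \in Delta.
  case: hDelta => /set0Pn[X XD] _ /(_ X _ XD); apply; exact: subsetT.
have [v vB [S SD [vx vy vle vS]]] :=
  separating_basis hpoly hg hDelta hcompat hg1 xD neq_xy.
have mem_block r t z : r \in Pi t -> (r \in Pi z) = (z == t).
  move=> rt; have [-> //|/disj/pred0P/(_ r)] := eqVneq z t.
  by rewrite /= rt andbT.
(* The participants [p] and [q] lie in different blocks, so removing them costs each block at most
   one member, and [v z <= g 0 < #|Pi z|] leaves enough. *)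
have le_u z : v z - (z == y) <= #|Pi z :\: [set p; q]|.
  apply: leq_trans (leq_subr _ _) _; apply: leq_trans (vle z) _.
  rewrite -ltnS; apply: leq_trans (hg0P z) _.
  rewrite -(cardsID [set p; q] (Pi z)) -add1n leq_add2r.
  apply/card_le1_eqP=> r t; rewrite !inE.
  have diff : (p \in Pi z) && (q \in Pi z) = false.
    rewrite (mem_block p x) // (mem_block q y) //.
    by case: eqP => // ->; rewrite (negPf neq_xy).
  move=> /andP[rz /orP[/eqP er|/eqP er]] /andP[tz /orP[/eqP et|/eqP et]];
    by move: diff; rewrite ?er ?et // -?er -?et rz tz.
have [A sA cA] := exists_set_counts disj le_u.
have [pA qA] : p \notin A /\ q \notin A.
  by split; apply/negP=> /(subsetP sA); rewrite !inE eqxx ?orbT.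
have count r t z : r \in Pi t -> r \notin A ->
    block_counts Pi (r |: A) z = (z == t) + (v z - (z == y)).
  move=> rt rA; rewrite ffunE -cA -(mem_block r t) // setIUl.
  have [rz|rz] := boolP (r \in Pi z).
    have /setIidPl -> : [set r] \subset Pi z by rewrite sub1set.
    by rewrite cardsU1 inE (negPf rA).
  suff -> : [set r] :&: Pi z = set0 by rewrite set0U.
  by apply/setP=> r1; rewrite !inE; case: eqP => // ->; rewrite (negPf rz).
have /hier : access_structure Pi h Delta (q |: A).
  exists v; split; first by exists [set: J].
  by move=> z; rewrite (count q y) // -leq_subLR.
case=> // w [[Z ZD wB] wle].
have ZS : Z \subset x |: S.
  apply: (dominated_basis_subset hpoly hg vB vx vy neq_xy vS wB) => z zx.
  have := wle z; rewrite (count p x) // (negPf zx) add0n.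
  (* At [y] the subtraction does not truncate: [v y = g 1] exceeds [g #|J|.-1], hence is
     positive. *)
  have [->|_] := eqVneq z y; last by rewrite subn0 addn0.
  by rewrite addn1 subn1 => /leq_ltn_trans; apply; rewrite prednK vy //
     (leq_ltn_trans _ hg1).
by case: hDelta SD => _ _ /(_ Z _ ZD ZS) ->.
Qed.
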